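(* Let $\theta_A$ be a condition number associated with real matrices $A$ (a real number assigned to each matrix) that remains unchanged by creating a duplicate copy of any row of $A$. There exists no function $f:\mathbb{N}\times\mathbb{R}\to\mathbb{N}$ and algorithm $\mathcal{A}$ that solves $\max c^\top x$ s.t. $Ax\le b$, for all $A\in\mathbb{R}^{m\times n}$, $b\in\mathbb{R}^m$, $c\in\mathbb{R}^n$, in $f(n,\theta_A)$ oracle queries, assuming the system $Ax\le b$ is given by a polyhedral separation oracle.
   Context: Polyhedral separation oracle for $P=\{x\in\mathbb{R}^n: Ax\le b\}$: given $\bar x\in\mathbb{R}^n$, it either confirms $\bar x\in P$ or returns a constraint $a_i^\top x\le b_i$ of the system $Ax\le b$ violated by $\bar x$, i.e. $a_i^\top\bar x>b_i$. The system $(A,b)$ is accessed only through the oracle; the number of rows $m$ is not bounded in terms of $n$. Solving means finding an exact optimal solution, or concluding infeasibility or unboundedness. *)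

(* Defs.v *)
From mathcomp Require Import all_boot all_order all_algebra.
From mathcomp Require Import classical_sets reals.

Set Implicit Arguments.
Unset Strict Implicit.
Unset Printing Implicit Defensive.

Import Order.TTheory GRing.Theory Num.Theory.

Local Open Scope classical_set_scope.
Local Open Scope ring_scope.

Definition polyhedron (R : realType) (m n : nat)
    (A : 'M[R]_(m, n)) (b : 'cV[R]_m) : set 'cV[R]_n :=
  [set x | forall i : 'I_m, (A *m x) i 0 <= b i 0].

Definition objective (R : realType) (n : nat) (c x : 'cV[R]_n) : R :=
  (c^T *m x) 0 0.

(* A violated constraint [a x <= beta] is returned as its data [(a, beta)],
   without its row index, so that an answer does not reveal the number of rows. *)
Inductive answer (R : realType) (n : nat) : Type :=
  | Inside
  | Violated (a : 'rV[R]_n) (beta : R).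
Arguments Inside {R n}.

Definition oracle (R : realType) (n : nat) : Type := 'cV[R]_n -> answer R n.

(* When several constraints are violated, any one of them may be returned. *)
Definition separation_oracle (R : realType) (m n : nat)
    (A : 'M[R]_(m, n)) (b : 'cV[R]_m) (O : oracle R n) : Prop :=
  forall x : 'cV[R]_n,
    match O x with
    | Inside => polyhedron A b x
    | Violated a beta =>
        exists i : 'I_m, [/\ a = row i A, beta = b i 0 & beta < (a *m x) 0 0]
    end.

Inductive outcome (R : realType) (n : nat) : Type :=
  | Optimal (x : 'cV[R]_n)
  | Infeasible
  | Unbounded.
Arguments Infeasible {R n}.
Arguments Unbounded {R n}.

Definition correct_outcome (R : realType) (m n : nat)
    (A : 'M[R]_(m, n)) (b : 'cV[R]_m) (c : 'cV[R]_n) (r : outcome R n) : Prop :=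
  match r with
  | Optimal x => polyhedron A b x /\
      (forall y, polyhedron A b y -> objective c y <= objective c x)
  | Infeasible => polyhedron A b = set0
  | Unbounded => forall M : R, exists2 x, polyhedron A b x & M < objective c x
  end.

Inductive action (R : realType) (n : nat) : Type :=
  | Ask (x : 'cV[R]_n)
  | Return (r : outcome R n).

(* The next action is a function of the past queries and answers, in
   chronological order; only queries are counted, computation is free. *)
Definition strategy (R : realType) (n : nat) : Type :=
  seq ('cV[R]_n * answer R n) -> action R n.

(* The inputs are the dimension, the value of the condition number and the
   objective vector; everything else has to be learnt from the oracle.  As in
   the usual oracle model for polyhedra, the complexity parameters (here the
   dimension and the condition number) are known; an algorithm that does not
   know the condition number is one that ignores this argument. *)
Definition algorithm (R : realType) : Type :=
  forall n : nat, R -> 'cV[R]_n -> strategy R n.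

(* [run s O k h] continues from history [h] with at most [k] further queries;
   [None] means that [s] asks for more than [k]. *)
Fixpoint run (R : realType) (n : nat) (s : strategy R n) (O : oracle R n)
    (k : nat) (h : seq ('cV[R]_n * answer R n)) : option (outcome R n) :=
  match s h with
  | Return r => Some r
  | Ask x => if k is k'.+1 then run s O k' (rcons h (x, O x)) else None
  end.

Definition duplication_invariant (R : realType)
    (theta : forall m n : nat, 'M[R]_(m, n) -> R) : Prop :=
  forall (m n : nat) (A : 'M[R]_(m, n)) (i : 'I_m),
    theta (m + 1)%N n (col_mx A (row i A)) = theta m n A.

(* One algorithm has to be correct, within the bound, for every system and for
   every separation oracle of that system. *)
Definition solves_within (R : realType)
    (theta : forall m n : nat, 'M[R]_(m, n) -> R)
    (f : nat -> R -> nat) (alg : algorithm R) : Prop :=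
  forall (m n : nat) (A : 'M[R]_(m, n)) (b : 'cV[R]_m) (c : 'cV[R]_n)
      (O : oracle R n),
    (0 < m)%N -> (0 < n)%N -> separation_oracle A b O ->
    exists2 r : outcome R n,
      run (alg n (theta m n A) c) O (f n (theta m n A)) [::] = Some r &
      correct_outcome A b c r.

(* Main.v *)
Require Import Defs.
From mathcomp Require Import all_boot all_order all_algebra.
From mathcomp Require Import reals.

(** In dimension one, let an adversary answer every query [x] with the
    constraint [y <= x - 1].  The algorithm then asks finitely many queries and
    stops, and these answers are all consistent with a system whose rows are
    copies of the row [1]: one per query, plus one that cuts off the point the
    algorithm returns, if any.  That system is feasible and bounded, so every
    outcome is wrong; and since its rows are all equal, its condition number,
    hence the number of allowed queries, does not depend on how many there are. *)

Set Implicit Arguments.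
Unset Strict Implicit.
Unset Printing Implicit Defensive.

Import Order.TTheory GRing.Theory Num.Theory.

Local Open Scope ring_scope.

Section Runs.
Variables (R : realType) (n : nat) (s : strategy R n).

Fixpoint queries (O : oracle R n) (k : nat) (h : seq ('cV[R]_n * answer R n)) :
    seq 'cV[R]_n :=
  match s h with
  | Return _ => [::]
  | Ask x => if k is k'.+1 then x :: queries O k' (rcons h (x, O x)) else [::]
  end.

(** The oracle enters the history only through its answers at the queried points. *)
Lemma eq_run (O O' : oracle R n) (k : nat) (h : seq ('cV[R]_n * answer R n)) :
  {in queries O k h, O =1 O'} -> run s O k h = run s O' k h.
Proof.
elim: k h => [|k IHk] h /=; case: (s h) => // x eqO.
rewrite -(eqO x) ?mem_head //; apply: IHk => y yq.
by apply: eqO; rewrite in_cons yq orbT.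
Qed.

End Runs.

Lemma duplication_invariant_const (R : realType)
    (theta : forall m n : nat, 'M[R]_(m, n) -> R) (a : R) (m n : nat) :
  duplication_invariant theta -> (0 < m)%N ->
  theta m n (const_mx a) = theta 1%N n (const_mx a).
Proof.
move=> htheta; case: m => // m _; elim: m => // m <-.
by rewrite -[RHS](htheta _ _ _ ord0) row_const col_mx_const addn1.
Qed.

Section Adversary.
Variable R : realType.
Implicit Types (x y : 'cV[R]_1) (Q : seq 'cV[R]_1).

Definition adversary : oracle R 1 :=
  fun x => Violated (const_mx 1) (x 0 0 - 1).

Definition cuts Q : 'cV[R]_(size Q) :=
  \col_i (tnth (in_tuple Q) i 0 0 - 1).

(** On [Q] the answer copies the adversary's, even if other rows are violated too; elsewhere any
    violated row will do. *)
Definition cut_oracle Q : oracle R 1 := fun x =>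
  if x \in Q then adversary x
  else if [pick i | cuts Q i 0 < x 0 0] is Some i
  then Violated (const_mx 1) (cuts Q i 0) else Inside.

Lemma mul_const_mx1 m x (i : 'I_m) : ((const_mx 1 : 'M_(m, 1)) *m x) i 0 = x 0 0.
Proof. by rewrite mxE big_ord1 mxE mul1r. Qed.

Lemma cut_oracleP Q : separation_oracle (const_mx 1) (cuts Q) (cut_oracle Q).
Proof.
move=> x; rewrite /cut_oracle; case: ifPn => [/seq_tnthP[i xE]|_].
  exists i; rewrite row_const mul_const_mx1 mxE -xE.
  by split=> //; rewrite gtrBl.
case: pickP => [i lt_i|no_i] /=.
  by exists i; rewrite row_const mul_const_mx1.
by move=> i; rewrite mul_const_mx1 leNgt no_i.
Qed.

Lemma cuts_infeasible Q x :
  x \in Q -> ~ polyhedron (const_mx 1) (cuts Q) x.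
Proof.
move=> /seq_tnthP[i xE] /(_ i).
by rewrite mul_const_mx1 mxE -xE lerDl oppr_ge0 ler10.
Qed.

Lemma cuts_feasible Q : exists x, polyhedron (const_mx 1) (cuts Q) x.
Proof.
(* Minus the sum of the absolute values of the bounds lies below each bound. *)
exists (const_mx (- \sum_i `|cuts Q i 0|)) => i; rewrite mul_const_mx1 mxE lerNl.
apply: le_trans (ler_norm _) _; rewrite normrN (bigD1 i) //= lerDl.
exact: sumr_ge0.
Qed.

Lemma cuts_wrong_outcome Q (r : outcome R 1) :
  (0 < size Q)%N -> (forall x, r = Optimal x -> x \in Q) ->
  ~ correct_outcome (const_mx 1) (cuts Q) (const_mx 1) r.
Proof.
move=> Q_gt0; case: r => [x|_|_] /=.
- by move=> /(_ x erefl) xQ [/(cuts_infeasible xQ)].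
- by have [x Px] := cuts_feasible Q => P0; rewrite P0 in Px.
(* The objective is the very coordinate that each row bounds, so one row excludes [Unbounded]. *)
pose i := Ordinal Q_gt0; move=> /(_ (cuts Q i 0)) [x /(_ i)].
by rewrite mul_const_mx1 /objective trmx_const mul_const_mx1 leNgt => /negP.
Qed.

End Adversary.

Theorem proposition1p4 (R : realType)
    (theta : forall m n : nat, 'M[R]_(m, n) -> R)
    (htheta : duplication_invariant theta) :
  ~ exists (f : nat -> R -> nat) (alg : algorithm R), solves_within theta f alg.
Proof.
move=> [f [alg solves]].
pose t := theta 1%N 1%N (const_mx 1); pose s := alg 1%N t (const_mx 1).
pose k := f 1%N t; pose r := run s (@adversary R) k [::].
(* The default [0] is arbitrary: without a returned point, [y] only keeps [Q] nonempty. *)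
pose y := if r is Some (Optimal x) then x else 0.
pose Q := y :: queries s (@adversary R) k [::].
have := solves _ _ _ _ (const_mx 1) _ (ltn0Sn _ : 0 < size Q)%N (ltn0Sn 0)
  (@cut_oracleP R Q).
(* The condition number becomes [t], so [s] and [k], fixed before [Q], also govern the run on this
   system. *)
rewrite duplication_invariant_const // -/t -/s -/k => -[r' run_r'].
have run_r : r = Some r'.
  rewrite -run_r'; apply: eq_run => x xq.
  by rewrite /cut_oracle in_cons xq orbT.
apply: cuts_wrong_outcome => // x r'E.
by rewrite in_cons /y run_r r'E eqxx.
Qed.
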